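(* For every positive integer $g$ there exist star-shaped sets 1) $X\subset\mathbb{R}^6$ satisfying $\chi(X)=2$ and $\gamma(X)\ge g$, and 2) $X_c\subset\mathbb{R}^6$ that is closed and satisfies $\chi(X_c)\le 4$ and $\gamma(X_c)\ge g$.
   Context: For $X\subseteq\mathbb{R}^d$, two points $x,y\in X$ see each other (within $X$) if the straight-line segment $\overline{xy}$ is a subset of $X$. The invisibility graph $I(X)$ is the (possibly infinite) graph with vertex set $X$ in which two points are adjacent if and only if they do not see each other. $\chi(X)$ is the chromatic number of $I(X)$. The convexity number $\gamma(X)$ is the minimum number of convex subsets of $X$ whose union is $X$ (possibly infinite). A set $X$ is star-shaped if it contains a point that sees every other point of $X$. *)

(* Defs.v *)
From HB Require Import structures.
From mathcomp Require Import all_boot all_order all_algebra.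
From mathcomp Require Import all_classical all_reals all_analysis.

Set Implicit Arguments.
Unset Strict Implicit.
Unset Printing Implicit Defensive.

Import Order.TTheory GRing.Theory Num.Theory.
Import numFieldNormedType.Exports.

Local Open Scope classical_set_scope.
Local Open Scope ring_scope.
Local Open Scope convex_scope.

Definition segment (R : realType) (d : nat) (x y : 'rV[R]_d) : set 'rV[R]_d :=
  range (fun t : {i01 R} =>
    (x : convex_lmodType 'rV[R]_d) <| t |> (y : convex_lmodType 'rV[R]_d)).

Definition sees (R : realType) (d : nat) (X : set 'rV[R]_d) (x y : 'rV[R]_d) :=
  segment x y `<=` X.

(* A graph is given by its adjacency relation on its type of vertices. The
   vertices of the invisibility graph are the points of X, the set X being
   coerced to the subtype of its elements. There are no loops, since a point
   of X sees itself. *)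
Definition invisibility_graph (R : realType) (d : nat) (X : set 'rV[R]_d) :
    X -> X -> Prop :=
  fun x y => ~ sees X (\val x) (\val y).

Definition proper_coloring (V : Type) (E : V -> V -> Prop) (n : nat)
    (c : V -> 'I_n) :=
  forall x y : V, E x y -> c x <> c y.

(* The two parameters below are minima of sets of natural numbers, or +oo if
   there is no such number: on a set of naturals embedded in \bar R, the
   infimum is attained unless the set is empty, and ereal_inf set0 = +oo. *)
Definition chromatic_number (R : realType) (V : Type) (E : V -> V -> Prop) :
    \bar R :=
  ereal_inf [set n%:R%:E | n in
    [set n : nat | exists c : V -> 'I_n, proper_coloring E c]].

Definition chi (R : realType) (d : nat) (X : set 'rV[R]_d) : \bar R :=
  chromatic_number R (@invisibility_graph R d X).

Definition convexity_number (R : realType) (d : nat) (X : set 'rV[R]_d) :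
    \bar R :=
  ereal_inf [set n%:R%:E | n in
    [set n : nat | exists C : 'I_n -> set 'rV[R]_d,
      (forall i, convex_set (C i : set (convex_lmodType 'rV[R]_d))) /\
      \bigcup_(i in [set: 'I_n]) C i = X]].

Definition star_shaped (R : realType) (d : nat) (X : set 'rV[R]_d) :=
  exists2 p, X p & forall x, X x -> sees X p x.

(* Main.v *)
Require Import Defs.
From HB Require Import structures.
From mathcomp Require Import all_boot all_order all_algebra.
From mathcomp Require Import all_classical all_reals all_analysis.
From mathcomp Require Import ring lra zify.
Import Order.TTheory GRing.Theory Num.Theory.
Import numFieldNormedType.Exports.
Local Open Scope classical_set_scope.
Local Open Scope ring_scope.

Set Implicit Arguments.
Unset Strict Implicit.
Unset Printing Implicit Defensive.

(** Both sets are carved out of a convex set in 6-space whose faces are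
controlled by the moment curve, and both have infinite convexity number.

Place a vertex v_n = (n, n^2, ..., n^6) for every natural number n. A
polynomial q of degree at most 6 is an affine form on 6-space whose value at
v_n is q(n) ([moment_form]). The square (X-a)^2 (X-b)^2 (X-c)^2 is such a form:
it is nonnegative at all vertices and vanishes only at v_a, v_b, v_c. So every
three vertices span a triangular face of the convex hull. Pairs of vertices
then carry no obstruction to convexity, and triples can be made to carry one:
deleting the barycenter of a triangle prevents its three vertices from lying
in the same convex piece, although each two of them see each other.

Only the triangles of a triple system T are spoiled. Two properties of T are
needed. It is unavoidable: every colouring of the vertices by finitely many
colours has a monochromatic triple. Colouring each vertex by a convex piece
that contains it, one sees that no finite family of convex pieces suffices
([convexity_number_punctured]). And it is linear: two triples share at most one
vertex, so that the spoiled triangles meet only at vertices and can be coloured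
almost independently of each other. Both hold when the vertices are the edges of the
complete graph on the naturals and the triples are the triangles of that graph:
two edges determine a triangle, and unavoidability is Ramsey's theorem for
triangles ([ramsey_triangle]).

For the first set take the points where all forms of the triples are positive,
together with the triangles of T minus their barycenters. Two points fail to
see each other only if they lie in one triangle on opposite sides of its
barycenter ([punctured_not_sees]). With u the barycentric coordinates minus
1/3, the sign of the product of the three entries of u changes under
u |-> -ku, k > 0, and is positive at the vertices. With a tie-break where the
product vanishes ([negative_side]) it gives a 2-colouring of each punctured
triangle, and these colourings agree at the common vertices.

For the closed set, an open cap around each barycenter is cut off. For a vertex
v_a of a triple t, a cap form takes the value 1 at v_a, the value 0 at the other
two vertices of t, and at most -4 at all remaining vertices. The cap of t is
where its three cap forms all exceed 1/4; it contains the barycenter, where they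
equal 1/3. Two points that fail to see each other must, for some t, together
violate the three inequalities (cap form at most 1/4) ([uncapped_not_sees]).
A point violating two inequalities of t violates none of any other triple
([caps_disjoint]), and it then gets one of three colours according to the
inequality of t that it satisfies; all other points share a fourth colour
([uncapped_same_color]).

In both cases the star centre is a vertex lying in no triple: all the forms
have the favourable sign there by a margin. *)

(** * Visibility and the graph parameters *)

(** Barycentric coordinates by plain reals are easier to compute with than
elements of the subtype [{i01 R}]. *)
Lemma segmentP (R : realType) (d : nat) (x y p : 'rV[R]_d) :
  segment x y p <->
  exists l : R, [/\ 0 <= l, l <= 1 & p = l *: x + (1 - l) *: y].
Proof.
split=> [[l _ <-]|[l [l0 l1 ->]]].
  by exists l%:num.
by exists (Itv01 l0 l1).
Qed.

Lemma not_seesP (R : realType) (d : nat) (X : set 'rV[R]_d) (x y : 'rV[R]_d) :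
  ~ sees X x y ->
  exists l : R, [/\ 0 <= l, l <= 1 & ~ X (l *: x + (1 - l) *: y)].
Proof.
move=> /existsNP[p /not_implyP[/segmentP[l [l0 l1 ->]] nX]].
by exists l.
Qed.

Lemma convex_set_conv (R : realType) (d : nat) (C : set 'rV[R]_d) (x y : 'rV[R]_d)
    (l : R) :
  convex_set (C : set (convex_lmodType 'rV[R]_d)) -> C x -> C y ->
  0 <= l -> l <= 1 -> C (l *: x + (1 - l) *: y).
Proof.
move=> cC Cx Cy l0 l1.
by have := cC x y (Itv01 l0 l1) (mem_set Cx) (mem_set Cy); rewrite inE.
Qed.

Lemma chi_le (R : realType) (d : nat) (X : set 'rV[R]_d) (F : finType)
    (c : X -> F) :
  (forall x y : X, ~ sees X (\val x) (\val y) -> c x <> c y) ->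
  (chi X <= #|F|%:R%:E)%E.
Proof.
move=> cP; apply: ereal_inf_lbound; exists #|F| => //=.
by exists (enum_rank \o c) => x y /cP cxy /= /enum_rank_inj.
Qed.

Lemma chi_ge2 (R : realType) (d : nat) (X : set 'rV[R]_d) (x y : 'rV[R]_d) :
  X x -> X y -> ~ sees X x y -> (2%:E <= chi X)%E.
Proof.
move=> Xx Xy nxy; apply: le_ereal_inf_tmp => _ [n [c cP] <-].
have := cP (SigSub (mem_set Xx)) (SigSub (mem_set Xy)) nxy.
move: (c _) (c _) => {cP c}; case: n => [[//]|[|n]] i j.
  by rewrite !ord1.
by move=> _; rewrite lee_fin ler_nat.
Qed.

(** * Affine forms on the moment curve *)

Definition moment (R : realType) (d : nat) (t : R) : 'rV[R]_d :=
  \row_(i < d) t ^+ i.+1.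

(** The linear functional on polynomials that sends X^0 to 1 and X^i to the
i-th coordinate of p, evaluated at q. *)
Definition moment_form (R : realType) (d : nat) (q : {poly R}) (p : 'rV[R]_d) : R :=
  q`_0 + \sum_(i < d) q`_i.+1 * p 0 i.

Lemma moment_form_moment (R : realType) (d : nat) (q : {poly R}) (t : R) :
  (size q <= d.+1)%N -> moment_form q (moment d t) = q.[t].
Proof.
move=> sq; rewrite (horner_coef_wide _ sq) big_ord_recl expr0 mulr1.
by congr (_ + _); apply: eq_bigr => i _; rewrite mxE.
Qed.

Lemma moment_form_sum (R : realType) (d : nat) (J : finType) (w : J -> R)
    (x : J -> 'rV[R]_d) (q : {poly R}) :
  \sum_j w j = 1 ->
  moment_form q (\sum_j w j *: x j) = \sum_j w j * moment_form q (x j).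
Proof.
move=> w1; under [RHS]eq_bigr do rewrite mulrDr.
rewrite big_split -mulr_suml w1 mul1r; congr (_ + _).
under [RHS]eq_bigr do rewrite mulr_sumr.
rewrite exchange_big; apply: eq_bigr => i _.
rewrite summxE mulr_sumr; apply: eq_bigr => j _.
by rewrite mxE mulrCA.
Qed.

Lemma moment_form_conv (R : realType) (d : nat) (x y : 'rV[R]_d) (q : {poly R})
    (l : R) :
  moment_form q (l *: x + (1 - l) *: y) =
  l * moment_form q x + (1 - l) * moment_form q y.
Proof.
rewrite /moment_form !mulrDr addrACA -mulrDl subrKC mul1r !mulr_sumr -big_split.
by congr (_ + _); apply: eq_bigr => i _; rewrite !mxE mulrDr !(mulrCA q`_i.+1).
Qed.

Lemma moment_form_continuous (R : realType) (d : nat) (q : {poly R}) :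
  continuous (@moment_form R d q).
Proof.
have sc : continuous (fun p : 'rV[R]_d => \sum_(i < d) q`_i.+1 * p 0 i).
  apply: continuous_big => [|i _ p]; first exact: add_continuous.
  apply: (@continuousM _ _ (fun=> q`_i.+1) (fun p : 'rV[R]_d => p 0 i)).
    exact: cst_continuous.
  exact: coord_continuous.
move=> p; apply: (@continuousD _ _ _ (fun=> q`_0)); last exact: sc.
exact: cst_continuous.
Qed.

(** * A linear and unavoidable triple system *)

(** Induction on the number m of colours that occur. Let x be the least vertex
and k a colour occurring on many edges from x. If k also occurs between two of
the corresponding neighbours, there is a triangle of colour k; otherwise the
neighbours span a graph with one colour less. *)
Lemma ramsey_triangle_aux (n : nat) (c : nat -> nat -> 'I_n) (m : nat) :
  exists N : nat, forall (A : {set 'I_n}) (s : seq nat),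
    (#|A| <= m)%N -> sorted ltn s -> (N <= size s)%N ->
    (forall i j, i \in s -> j \in s -> (i < j)%N -> c i j \in A) ->
  exists i j k, [/\ (i < j)%N, (j < k)%N, c i j = c i k & c j k = c i k].
Proof.
elim: m => [|m [N IH]].
  exists 2 => A [|x [|y s]] //=; rewrite leqn0 cards_eq0 => /eqP -> /andP[xy _] _.
  by move=> /(_ x y); rewrite !inE !eqxx orbT => /(_ isT isT xy).
exists (n * N).+2 => A [|x s] //= cA; rewrite (path_sortedE ltn_trans).
move=> /andP[/allP xs srt]; rewrite ltnS => szs cs.
have [k kN] : exists k : 'I_n, (N < count (fun y => c x y == k) s)%N.
  apply: contrapT => /forallNP nk.
  have : (\sum_(k < n) count (fun y => c x y == k) s <= \sum_(k < n) N)%N.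
    by apply: leq_sum => k _; have /negP := nk k; rewrite -leqNgt.
  rewrite sum_nat_const card_ord.
  under eq_bigr do rewrite -sum1_count.
  rewrite (exchange_big_dep xpredT) //=.
  under eq_bigr => y _.
    rewrite (big_pred1 (c x y)); last by move=> k; rewrite /= eq_sym.
  over.
  by rewrite sum1_size leqNgt szs.
pose s' := [seq y <- s | c x y == k].
have s'P y : y \in s' -> [/\ y \in s, (x < y)%N & c x y = k].
  by rewrite mem_filter => /andP[/eqP ? ys]; split => //; apply: xs.
have [[i [j [si sj ij cij]]]|nk] :=
    pselect (exists i j, [/\ i \in s', j \in s', (i < j)%N & c i j = k]).
  have [_ xi ci] := s'P _ si; have [_ xj cj] := s'P _ sj.
  by exists x, i, j; rewrite ci cj cij.
apply: (IH (A :\ k)%SET s').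
- have kA : k \in A.
    have : has (fun y => c x y == k) s by rewrite has_count (leq_trans _ kN).
    case/hasP => y ys /eqP <-.
    by apply: cs; rewrite ?inE ?eqxx ?ys ?orbT // xs.
  by move: cA; rewrite (cardsD1 k) kA.
- exact: (sorted_filter ltn_trans).
- by rewrite size_filter ltnW.
- move=> i j si sj ij; rewrite !inE; apply/andP; split.
    by apply/eqP => cij; apply: nk; exists i, j.
  have [sis _ _] := s'P _ si; have [sjs _ _] := s'P _ sj.
  by apply: cs; rewrite // inE ?sis ?sjs orbT.
Qed.

Lemma ramsey_triangle (n : nat) (c : nat -> nat -> 'I_n) :
  exists i j k, [/\ (i < j)%N, (j < k)%N, c i j = c i k & c j k = c i k].
Proof.
have [N NP] := ramsey_triangle_aux c n.
apply: (NP [set: 'I_n]%SET (iota 0 N)) => //.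
- by rewrite cardsT card_ord.
- exact: iota_ltn_sorted.
- by rewrite size_iota.
- by move=> i j _ _ _; rewrite inE.
Qed.

Definition linear_triples (I : Type) (T : I -> 'I_3 -> nat) :=
  forall s t a a' b b',
    a <> a' -> T s a = T t b -> T s a' = T t b' -> s = t.

Definition unavoidable_triples (I : Type) (T : I -> 'I_3 -> nat) :=
  forall (n : nat) (c : nat -> 'I_n), exists t k, forall a, c (T t a) = k.

Definition triangle := {i : nat * nat * nat | (i.1.1 < i.1.2 < i.2)%N}.

(** Edges of the complete graph on the naturals are numbered by [pickle], since
the vertices of a triple system are natural numbers. *)
Definition triangle_edges (t : triangle) (a : 'I_3) : nat :=
  let: (i, j, k) := \val t in
  nth 0%N [:: pickle (i, j); pickle (j, k); pickle (i, k)] a.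

Lemma pickle_pair_inj (i j k l : nat) :
  pickle (i, j) = pickle (k, l) -> i = k /\ j = l.
Proof. by move=> /(pcan_inj pickleK) [-> ->]. Qed.

Lemma ord3P (P : 'I_3 -> Prop) : P 0 -> P 1 -> P 2 -> forall a, P a.
Proof.
move=> P0 P1 P2 [[|[|[|//]]] i].
- by rewrite (_ : Ordinal i = 0) //; apply: val_inj.
- by rewrite (_ : Ordinal i = 1) //; apply: val_inj.
- by rewrite (_ : Ordinal i = 2) //; apply: val_inj.
Qed.

Lemma big_ord3 (V : nmodType) (F : 'I_3 -> V) :
  \sum_a F a = F 0 + F 1 + F 2.
Proof.
rewrite !big_ord_recl big_ord0 addr0 addrA.
by congr (_ + F _ + F _); apply: val_inj.
Qed.

Lemma triangle_edges_inj (t : triangle) : injective (triangle_edges t).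
Proof.
case: t => [[[i j] k] ijk]; rewrite /triangle_edges /=.
by apply: ord3P; apply: ord3P => //= /pickle_pair_inj[? ?]; move: ijk => /=; lia.
Qed.

(** Two edges of a triangle determine its three vertices. *)
Lemma triangle_edges_linear : linear_triples triangle_edges.
Proof.
move=> [[[i j] k] ijk] [[[i' j'] k'] ijk'] a a' b b' aa'.
rewrite /triangle_edges /= => e e'; apply: val_inj; move: ijk ijk' => /= ijk ijk'.
move: a a' b b' aa' e e'.
by apply: ord3P; apply: ord3P; apply: ord3P; apply: ord3P => //= _
  /pickle_pair_inj[? ?] /pickle_pair_inj[? ?]; subst => //; lia.
Qed.

Lemma triangle_edges_unavoidable : unavoidable_triples triangle_edges.
Proof.
move=> n c.
have [i [j [k [ij jk e1 e2]]]] := ramsey_triangle (fun i j => c (pickle (i, j))).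
have ijk : (i < j < k)%N by rewrite ij.
exists (exist _ (i, j, k) ijk), (c (pickle (i, k))).
by apply: ord3P; rewrite /triangle_edges /=.
Qed.

(** As the edges in use are pairs i < j, the number of a diagonal pair lies in no
triple; it will be the star centre. *)
Lemma triangle_edges_diag (t : triangle) (a : 'I_3) :
  triangle_edges t a <> pickle (0%N, 0%N).
Proof.
case: t => [[[i j] k] ijk]; rewrite /triangle_edges /=.
by move: a; apply: ord3P => /pickle_pair_inj[? ?]; move: ijk => /=; lia.
Qed.

(** * Triangles with vertices on the moment curve *)

Section Triples.
Context {R : realType} {I : Type} (T : I -> 'I_3 -> nat).
Hypothesis T_inj : forall t, injective (T t).
Implicit Types (t s : I) (a b : 'I_3) (n : nat) (p : 'rV[R]_6).

Local Notation vertex n := (moment 6 (n%:R : R)).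

(** As a form, this one is a supporting functional of the convex hull of the
vertices, touching it exactly along the triangle of t. *)
Definition face_poly t : {poly R} := \prod_(b < 3) ('X - ((T t b)%:R)%:P) ^+ 2.

(** The Lagrange polynomials of t: as forms they restrict to the barycentric
coordinates on the triangle of t. *)
Definition weight_poly t a : {poly R} :=
  \prod_(b | b != a)
    (((T t a)%:R - (T t b)%:R)^-1 *: ('X - ((T t b)%:R)%:P)).

Lemma size_face_poly t : (size (face_poly t) <= 7)%N.
Proof.
apply: (leq_trans (size_prod_leq _ _)).
under eq_bigr do rewrite size_exp_XsubC.
by rewrite sum_nat_const card_ord.
Qed.

Lemma size_weight_poly t a : (size (weight_poly t a) <= 7)%N.
Proof.
apply: (leq_trans (size_prod_leq _ _)).
rewrite (leq_trans (leq_subr _ _)) // ltnS.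
apply: (@leq_trans (\sum_(b | b != a) 2)%N).
  by apply: leq_sum => b _; rewrite (leq_trans (size_scale_leq _ _)) ?size_XsubC.
rewrite sum_nat_const; have := max_card (fun b => b != a).
by rewrite card_ord => c3; exact: (leq_mul c3 (leqnn 2)).
Qed.

(** The vertices have integral parameters in order to have this gap, which makes
the bounds below uniform over the infinitely many vertices. *)
Lemma natr_dist_ge1 (m n : nat) : m <> n -> 1 <= `|m%:R - n%:R : R|.
Proof.
have ltP i j : (j < i)%N -> 1 <= `|i%:R - j%:R : R|.
  by move=> ji; rewrite -natrB 1?ltnW // normr_nat ler1n subn_gt0.
by have [/ltP|/ltP|->] := ltngtP n m => //; rewrite distrC.
Qed.

Lemma face_vertex t b : moment_form (face_poly t) (vertex (T t b)) = 0.
Proof.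
rewrite moment_form_moment ?size_face_poly // horner_prod (bigD1 b) //=.
by rewrite horner_exp !hornerE subrr expr0n mul0r.
Qed.

Lemma face_vertex_ge0 t n : 0 <= moment_form (face_poly t) (vertex n).
Proof.
rewrite moment_form_moment ?size_face_poly // horner_prod.
by apply: prodr_ge0 => b _; rewrite horner_exp sqr_ge0.
Qed.

Lemma face_vertex_ge1 t n : (forall b, n <> T t b) ->
  1 <= moment_form (face_poly t) (vertex n).
Proof.
move=> nT; rewrite moment_form_moment ?size_face_poly // horner_prod.
rewrite [leLHS](_ : 1 = \prod_(b < 3) 1); last by rewrite big1.
apply: ler_prod => b _; rewrite ler01 horner_exp !hornerE /=.
by rewrite -real_normK ?num_real // expr_ge1 // natr_dist_ge1.
Qed.

Lemma weight_vertex t a b :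
  moment_form (weight_poly t a) (vertex (T t b)) = (a == b)%:R.
Proof.
rewrite moment_form_moment ?size_weight_poly // horner_prod.
have [<-|ab] := eqVneq a b; last first.
  by rewrite (bigD1 b) 1?eq_sym //= !hornerE subrr mulr0 mul0r.
rewrite big1 // => c ca; rewrite !hornerE mulVf // subr_eq0 eqr_nat.
by apply: contra ca => /eqP /T_inj ->.
Qed.

(** Off t, a Lagrange polynomial has denominators at least 1 in absolute value,
and each factor of its numerator is at least 1, hence at most its own square. *)
Lemma weight_vertex_le t a n : (forall b, n <> T t b) ->
  moment_form (weight_poly t a) (vertex n) <=
  moment_form (face_poly t) (vertex n).
Proof.
move=> nT; rewrite !moment_form_moment ?size_face_poly ?size_weight_poly //.
rewrite !horner_prod [leRHS](bigD1 a) //= horner_exp !hornerE.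
have le_sqr b : 1 <= `|n%:R - (T t b)%:R : R| by apply: natr_dist_ge1.
apply: (le_trans (ler_norm _)); rewrite normr_prod.
rewrite -[leLHS]mul1r ler_pM ?prodr_ge0 //.
  by rewrite -real_normK ?num_real // expr_ge1.
apply: ler_prod => b ba; rewrite normr_ge0 /= horner_exp !hornerE normrM normfV.
rewrite -[leRHS]real_normK ?num_real // expr2 ler_pM ?invr_ge0 //.
rewrite (le_trans _ (le_sqr b)) // invf_le1 ?natr_dist_ge1 //.
  by move=> /T_inj ab; rewrite ab eqxx in ba.
rewrite (lt_le_trans ltr01) // natr_dist_ge1 // => /T_inj ab.
by rewrite ab eqxx in ba.
Qed.

Definition combination t (w : 'I_3 -> R) : 'rV[R]_6 :=
  \sum_a w a *: vertex (T t a).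

Definition hole t := combination t (fun=> 3^-1).

Definition in_face t p :=
  exists w : 'I_3 -> R,
    [/\ forall a, 0 <= w a, \sum_a w a = 1 & p = combination t w].

Local Notation face t := (moment_form (face_poly t)).
Local Notation weight t a := (moment_form (weight_poly t a)).

Lemma third_sum : \sum_(a < 3) 3^-1 = 1 :> R.
Proof. by rewrite big_ord3; field. Qed.

Lemma face_combination t (w : 'I_3 -> R) : \sum_a w a = 1 ->
  face t (combination t w) = 0.
Proof.
by move=> w1; rewrite moment_form_sum // big1 // => a _; rewrite face_vertex mulr0.
Qed.

Lemma weight_combination t a (w : 'I_3 -> R) : \sum_a w a = 1 ->
  weight t a (combination t w) = w a.
Proof.
move=> w1; rewrite moment_form_sum // (bigD1 a) //= weight_vertex eqxx mulr1.
rewrite big1 ?addr0 // => b /negbTE ba.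
by rewrite weight_vertex eq_sym ba mulr0.
Qed.

Lemma in_faceE t p : in_face t p -> p = combination t (fun a => weight t a p).
Proof.
by move=> [w [_ w1 ->]]; apply: eq_bigr => a _; rewrite weight_combination.
Qed.

Lemma in_face_weight_sum t p : in_face t p -> \sum_a weight t a p = 1.
Proof.
move=> [w [_ w1 ->]]; rewrite -[RHS]w1.
by apply: eq_bigr => a _; rewrite weight_combination.
Qed.

Lemma in_face_face t p : in_face t p -> face t p = 0.
Proof. by move=> [w [_ w1 ->]]; rewrite face_combination. Qed.

Lemma in_face_hole t : in_face t (hole t).
Proof.
by exists (fun=> 3^-1); split=> [a||//]; [rewrite invr_ge0|exact: third_sum].
Qed.

Lemma in_face_vertex t a : in_face t (vertex (T t a)).
Proof.
exists (fun b => (b == a)%:R); split=> [b||]; first exact: ler0n.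
  by rewrite (bigD1 a) //= eqxx big1 ?addr0 // => b /negbTE ->.
rewrite /combination (bigD1 a) //= eqxx scale1r big1 ?addr0 // => b /negbTE ->.
by rewrite scale0r.
Qed.

Lemma in_face_conv t p q (l : R) : in_face t p -> in_face t q ->
  0 <= l -> l <= 1 -> in_face t (l *: p + (1 - l) *: q).
Proof.
move=> [v [v0 v1 ->]] [w [w0 w1 ->]] l0 l1.
exists (fun a => l * v a + (1 - l) * w a); split.
- by move=> a; rewrite addr_ge0 // mulr_ge0 // subr_ge0.
- by rewrite big_split -!mulr_sumr /= v1 w1 !mulr1 subrKC.
- rewrite /combination !scaler_sumr -big_split; apply: eq_bigr => a _.
  by rewrite /= !scalerA -scalerDl.
Qed.

Lemma in_face_ge0 s t p : in_face t p -> 0 <= face s p.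
Proof.
move=> [w [w0 w1 ->]]; rewrite moment_form_sum //.
by apply: sumr_ge0 => a _; rewrite mulr_ge0 // face_vertex_ge0.
Qed.

(** Since the form of s is positive at all vertices outside s, a point of the
triangle of t killed by it is a combination of vertices common to s and t. By
linearity there is only one of these unless t = s. *)
Lemma in_face_meet s t p : linear_triples T -> in_face t p -> face s p = 0 ->
  t = s \/ exists a b, T t a = T s b /\ p = vertex (T t a).
Proof.
move=> lin [w [w0 w1 ->]]; rewrite moment_form_sum // => /eqP.
rewrite psumr_eq0 => [|a _]; last by rewrite mulr_ge0 // face_vertex_ge0.
move=> /allP w00.
have supp a : w a != 0 -> exists b, T t a = T s b.
  move=> wa; apply: contrapT => /forallNP nT.
  have := w00 a (mem_index_enum a); rewrite mulf_eq0 (negbTE wa) /=.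
  by rewrite gt_eqF // (lt_le_trans ltr01) // face_vertex_ge1.
have [a wa] : exists a, w a != 0.
  apply: contrapT => /forallNP nw; have /eqP := w1.
  rewrite big1 ?(eq_sym 0) ?oner_eq0 // => a _.
  by apply/eqP; have /negP := nw a; rewrite negbK.
have [[a' a'a wa']|only_a] := pselect (exists2 a', a' <> a & w a' != 0).
  left; have [b e] := supp _ wa; have [b' e'] := supp _ wa'.
  by apply: (lin _ _ _ _ _ _ a'a e' e).
have w_eq0 b : b != a -> w b = 0.
  move=> /eqP ba; apply: contrapT => /eqP wb.
  by apply: only_a; exists b.
right; have [b e] := supp _ wa; exists a, b; split => //.
have wa1 : w a = 1 by rewrite -w1 (bigD1 a) //= big1 ?addr0 // => c /w_eq0.
rewrite /combination (bigD1 a) //= wa1 scale1r big1 ?addr0 // => c /w_eq0 ->.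
by rewrite scale0r.
Qed.

Lemma hole_not_in_face s t : linear_triples T -> in_face s (hole t) -> t = s.
Proof.
move=> lin /in_face_face sh.
have [//|] := in_face_meet lin (in_face_hole t) sh.
move=> [a [_ [_ /(congr1 (weight t a)) ha]]]; exfalso; move: ha.
rewrite weight_combination ?third_sum // weight_vertex eqxx /=; lra.
Qed.

Lemma convex_hole (C : set 'rV[R]_6) t :
  convex_set (C : set (convex_lmodType 'rV[R]_6)) ->
  (forall a, C (vertex (T t a))) -> C (hole t).
Proof.
move=> cC CT.
have -> : hole t = 3^-1 *: vertex (T t 0) +
    (1 - 3^-1) *: (2^-1 *: vertex (T t 1) + (1 - 2^-1) *: vertex (T t 2)).
  rewrite /hole /combination big_ord3 scalerDr addrA !scalerA.
  by congr (_ + _ *: _ + _ *: _); field.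
by apply: convex_set_conv => //; [apply: convex_set_conv => //; lra | lra].
Qed.

(** A convex piece that contains the three vertices of a triple contains its
hole; so a finite cover by convex pieces would colour the vertices without a
monochromatic triple. *)
Lemma convexity_number_punctured (X : set 'rV[R]_6) :
  unavoidable_triples T -> (forall n, X (vertex n)) ->
  (forall t, ~ X (hole t)) -> convexity_number X = +oo%E.
Proof.
move=> unav Xv Xh; rewrite /convexity_number.
rewrite (_ : [set _ | _ in _] = set0) ?ereal_inf0 //.
apply/seteqP; split => // _ [m [C [cC CX]] _] /=.
have cover n : exists i, C i (vertex n).
  by have := Xv n; rewrite -CX => -[i _ Ci]; exists i.
have [c cP] := choice cover.
have [t [k tk]] := unav m c.
apply: (Xh t); rewrite -CX; exists k => //.
by apply: convex_hole => // a; rewrite -(tk a).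
Qed.

(** * The set with chromatic number 2 *)

Hypothesis T_linear : linear_triples T.

Definition punctured_faces : set 'rV[R]_6 :=
  [set p | (forall t, 0 < face t p) \/ exists2 t, in_face t p & p <> hole t].

Lemma punctured_face_ge0 t p : punctured_faces p -> 0 <= face t p.
Proof. by case=> [/(_ t)/ltW //|[s /in_face_ge0]]. Qed.

Lemma punctured_face_eq0 t p : punctured_faces p -> face t p = 0 -> in_face t p.
Proof.
case=> [/(_ t) p0 p00|[s sp _] p0]; first by rewrite p00 ltxx in p0.
have [<- //|] := in_face_meet T_linear sp p0.
by move=> [a [b [e ->]]]; rewrite e; exact: in_face_vertex.
Qed.

Lemma punctured_hole t : ~ punctured_faces (hole t).
Proof.
case=> [/(_ t)|[s sh ns]].
  by rewrite face_combination ?third_sum ?ltxx.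
by apply: ns; rewrite (hole_not_in_face T_linear sh).
Qed.

Lemma punctured_vertex n : punctured_faces (vertex n).
Proof.
have [[t [a na]]|nT] := pselect (exists t a, n = T t a).
  right; exists t; rewrite na; first exact: in_face_vertex.
  move=> /(congr1 (weight t a)).
  rewrite weight_combination ?third_sum // weight_vertex eqxx /=; lra.
left=> t; rewrite (lt_le_trans ltr01) // face_vertex_ge1 // => a na.
by apply: nT; exists t, a.
Qed.

(** If some form of a triple vanishes at an inner point of the segment, it
vanishes at both ends, which then lie in one triangle; otherwise the open
segment stays where all the forms are positive. *)
Lemma punctured_not_sees p q :
  punctured_faces p -> punctured_faces q -> ~ sees punctured_faces p q ->
  exists t l, [/\ in_face t p, in_face t q, 0 < l, l < 1 &
    hole t = l *: p + (1 - l) *: q].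
Proof.
move=> Xp Xq /not_seesP[l [l0 l1]].
have [->|ln0] := eqVneq l 0; first by rewrite scale0r subr0 add0r scale1r.
have [->|ln1] := eqVneq l 1; first by rewrite subrr scale0r addr0 scale1r.
have lgt0 : 0 < l by rewrite lt_neqAle eq_sym ln0.
have llt1 : l < 1 by rewrite lt_neqAle ln1.
move=> nX; move: (nX) => /not_orP[/existsNP[t] + /forall2NP].
rewrite moment_form_conv => /negP; rewrite -leNgt => le0.
have p0 := punctured_face_ge0 t Xp; have q0 := punctured_face_ge0 t Xq.
have lp0 := mulr_ge0 (ltW lgt0) p0.
have lq0 : 0 <= (1 - l) * face t q by rewrite mulr_ge0 // subr_ge0.
have Fp : in_face t p.
  apply: punctured_face_eq0 => //; apply/eqP.
  by rewrite -(mulrI_eq0 _ (lregP ln0)); apply/eqP; lra.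
have Fq : in_face t q.
  apply: punctured_face_eq0 => //; apply/eqP.
  have ln1' : 1 - l != 0 by rewrite subr_eq0 eq_sym.
  by rewrite -(mulrI_eq0 _ (lregP ln1')); apply/eqP; lra.
move=> /(_ t)[[]|/contrapT hE]; first exact: in_face_conv.
by exists t, l.
Qed.

Lemma punctured_star n : (forall t a, T t a <> n) -> star_shaped punctured_faces.
Proof.
move=> nT; exists (vertex n); first exact: punctured_vertex.
move=> p Xp; apply: contrapT => /(punctured_not_sees (punctured_vertex n) Xp).
move=> [t [_ [/in_face_face + _ _ _ _]]]; apply/eqP.
by rewrite gt_eqF // (lt_le_trans ltr01) // face_vertex_ge1 // => a /esym/nT.
Qed.

(** The tie-break by the first nonzero coordinate makes the sign odd also on the
lines where the product vanishes. *)
Definition negative_side (u v w : R) : bool :=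
  (u * v * w < 0) || (u * v * w == 0) && ((u < 0) || (u == 0) && (v < 0)).

Lemma negative_side_antipodal (u v w k : R) :
  0 < k -> u + v + w = 0 -> (u != 0) || (v != 0) ->
  negative_side (- k * u) (- k * v) (- k * w) = ~~ negative_side u v w.
Proof.
move=> k0 uvw uv0; rewrite /negative_side.
have -> : - k * u * (- k * v) * (- k * w) = - k ^+ 3 * (u * v * w) by ring.
have k30 : - k ^+ 3 < 0 by rewrite oppr_lt0 exprn_gt0.
have nk0 : - k < 0 by rewrite oppr_lt0.
rewrite !(nmulr_rlt0 _ k30) !(nmulr_rlt0 _ nk0) !mulf_eq0.
rewrite !(lt_eqF k30) !(lt_eqF nk0) /=.
rewrite -!mulf_eq0.
have [_|_|_] := ltgtP (u * v * w) 0 => //=.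
have [_|_|u0] := ltgtP u 0 => //=.
have [_|_|v0] := ltgtP v 0 => //=.
by rewrite u0 v0 eqxx in uv0.
Qed.

Definition on_negative_side t p : bool :=
  negative_side (weight t 0 p - 3^-1) (weight t 1 p - 3^-1) (weight t 2 p - 3^-1).

(** At a vertex the shifted coordinates are 2/3, -1/3, -1/3, whose product is
positive: the colourings of all the triangles through a vertex agree there. *)
Lemma vertex_side t a : on_negative_side t (vertex (T t a)) = false.
Proof.
rewrite /on_negative_side !weight_vertex /negative_side.
move: a; apply: ord3P => /=; rewrite ?eqxx; lra.
Qed.

Definition side_color (p : 'rV[R]_6) : bool :=
  `[< exists2 t, in_face t p & on_negative_side t p >].

(** The colour does not depend on the triangle used to compute it, because a point
of two triangles is a vertex. *)
Lemma side_colorE t p : in_face t p -> side_color p = on_negative_side t p.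
Proof.
move=> tp; apply/asboolP/idP => [[s sp neg]|neg]; last by exists t.
have [<- //|] := in_face_meet T_linear sp (in_face_face tp).
by move=> [a [b [_ pa]]]; rewrite pa vertex_side in neg.
Qed.

Lemma hole_between t p q (l : R) :
  in_face t p -> in_face t q -> p <> hole t -> 0 < l -> l < 1 ->
  hole t = l *: p + (1 - l) *: q ->
  on_negative_side t q = ~~ on_negative_side t p.
Proof.
move=> tp tq ph l0 l1 hE.
have k0 : 0 < l / (1 - l) by rewrite divr_gt0 // subr_gt0.
have l1n0 : 1 - l != 0 by rewrite subr_eq0 gt_eqF.
have weightE a : weight t a q - 3^-1 = - (l / (1 - l)) * (weight t a p - 3^-1).
  have := congr1 (weight t a) hE.
  rewrite weight_combination ?third_sum // moment_form_conv => e.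
  have e' : (1 - l) * weight t a q = 3^-1 - l * weight t a p.
    by rewrite e [l * _ + _]addrC addrK.
  have -> : weight t a q = (3^-1 - l * weight t a p) / (1 - l).
    by rewrite -e' mulrC mulKf.
  by field.
rewrite /on_negative_side !weightE negative_side_antipodal //.
  by have := in_face_weight_sum tp; rewrite big_ord3 => wp; clear ph; lra.
apply: contraT; rewrite negb_or !negbK => /andP[/eqP w0 /eqP w1].
exfalso; apply: ph; rewrite (in_faceE tp); apply: eq_bigr => a _.
congr (_ *: _); have := in_face_weight_sum tp; rewrite big_ord3.
by move: a w0 w1; clear; apply: ord3P; lra.
Qed.

Lemma chi_punctured : unavoidable_triples T -> chi punctured_faces = 2%:E.
Proof.
move=> unav; apply/eqP; rewrite eq_le; apply/andP; split.
  have <- : #|{: bool}|%:R = 2 :> R by rewrite card_bool.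
  apply: (chi_le (c := fun p : punctured_faces => side_color (\val p))) => p q.
  have Xp : punctured_faces (\val p) := set_valP p.
  have Xq : punctured_faces (\val q) := set_valP q.
  move=> /(punctured_not_sees Xp Xq) [t [l [tp tq l0 l1 hE]]].
  rewrite (side_colorE tp) (side_colorE tq) (hole_between tp tq _ l0 l1 hE).
    by case: on_negative_side.
  by move=> ph; apply: (@punctured_hole t); rewrite -ph.
have [t _] := unav 1%N (fun=> ord0).
(* The midpoint of the edge opposite to a vertex lies behind the hole. *)
pose w (a : 'I_3) : R := if a == 0 then 0 else 2^-1.
have w1 : \sum_a w a = 1.
  by rewrite big_ord3 /w /=; lra.
have tw : in_face t (combination t w).
  by exists w; split=> // a; rewrite /w; case: ifP => // _; lra.
apply: (@chi_ge2 _ _ _ (vertex (T t 0)) (combination t w)).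
- exact: punctured_vertex.
- right; exists t => // /(congr1 (weight t 0)).
  by rewrite !weight_combination ?third_sum // /w /=; lra.
move=> /(_ (hole t)) sh; apply: (@punctured_hole t); apply: sh.
apply/segmentP; exists 3^-1; split; [lra|lra|].
rewrite /hole /combination !big_ord3 /w /= scale0r add0r.
rewrite scalerDr addrA !scalerA.
by congr (_ + _ *: _ + _ *: _); field.
Qed.

(** * The closed set *)

(** The coefficient 5 pushes the values at vertices outside t, where the weight
is at most the face form and the latter at least 1, down to -4. *)
Definition cap_poly t a : {poly R} := weight_poly t a - 5 *: face_poly t.

Local Notation cap t a := (moment_form (cap_poly t a)).

Lemma size_cap_poly t a : (size (cap_poly t a) <= 7)%N.
Proof.
rewrite (leq_trans (size_polyD _ _)) // geq_max size_weight_poly size_polyN.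
by rewrite (leq_trans (size_scale_leq _ _)) ?size_face_poly.
Qed.

Lemma cap_vertexE t a n :
  cap t a (vertex n) = weight t a (vertex n) - 5 * face t (vertex n).
Proof.
rewrite !moment_form_moment ?size_cap_poly ?size_face_poly ?size_weight_poly //.
by rewrite /cap_poly !hornerE.
Qed.

Lemma cap_vertex t a b : cap t a (vertex (T t b)) = (a == b)%:R.
Proof. by rewrite cap_vertexE weight_vertex face_vertex mulr0 subr0. Qed.

Lemma cap_vertex_far t a n : (forall b, n <> T t b) -> cap t a (vertex n) <= - 4.
Proof.
move=> nT; rewrite cap_vertexE.
by have := weight_vertex_le a nT; have := face_vertex_ge1 nT; lra.
Qed.

Lemma cap_hole t a : cap t a (hole t) = 3^-1.
Proof.
rewrite moment_form_sum ?third_sum // (bigD1 a) //= cap_vertex eqxx mulr1.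
by rewrite big1 ?addr0 // => b /negbTE ba; rewrite cap_vertex eq_sym ba mulr0.
Qed.

(** The inequalities hold at all vertices. For a vertex a of t outside s, they
exclude that [cap t a p] and [cap s b p] both exceed 1/4, so that being close to
a vertex outside s excludes being close to the triangle of s. Taking this set
instead of the convex hull of the vertices makes closedness immediate. *)
Definition separating_polyhedron : set 'rV[R]_6 :=
  [set p | forall t s a b, t <> s -> (forall c, T t a <> T s c) ->
    cap t a p + 4^-1 * cap s b p <= 4^-1 + 4^-1 * 4^-1].

Definition uncapped_polyhedron : set 'rV[R]_6 :=
  [set p | separating_polyhedron p /\ forall t, exists a, cap t a p <= 4^-1].

(** If v_n is the vertex a of t, it is outside s and the sum is at most
1 - 4/4 = 0; otherwise the first term is at most 0 and the second at most 1/4. *)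
Lemma separating_vertex n : separating_polyhedron (vertex n).
Proof.
move=> t s a b ts nT.
have [na|na] := eqVneq n (T t a).
  rewrite na cap_vertex eqxx /=.
  by have := @cap_vertex_far s b _ nT; lra.
have capt : cap t a (vertex n) <= 0.
  have [[c nc]|nt] := pselect (exists c, n = T t c).
    rewrite nc cap_vertex (_ : a == c = false) //.
    by apply/negP => /eqP ac; rewrite nc ac eqxx in na.
  apply: le_trans (@cap_vertex_far t a n _) _; last by lra.
  by move=> c nc; apply: nt; exists c.
have caps : cap s b (vertex n) <= 1.
  have [[c ->]|ns] := pselect (exists c, n = T s c).
    by rewrite cap_vertex lern1 leq_b1.
  apply: le_trans (@cap_vertex_far s b n _) _; last by lra.
  by move=> c nc; apply: ns; exists c.
clear -capt caps; lra.
Qed.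

Lemma separating_conv p q (l : R) :
  separating_polyhedron p -> separating_polyhedron q -> 0 <= l -> l <= 1 ->
  separating_polyhedron (l *: p + (1 - l) *: q).
Proof.
move=> sp sq l0 l1 t s a b ts nT; rewrite !moment_form_conv.
have := ler_wpM2l l0 (sp t s a b ts nT).
have l1' : 0 <= 1 - l by rewrite subr_ge0.
have := ler_wpM2l l1' (sq t s a b ts nT).
clear; lra.
Qed.

Lemma uncapped_vertex n : uncapped_polyhedron (vertex n).
Proof.
split; first exact: separating_vertex.
move=> t; have [[c ->]|nt] := pselect (exists c, n = T t c).
  exists (if c == 0 then 1 else 0); rewrite cap_vertex.
  by move: c; apply: ord3P => /=; lra.
exists 0; apply: le_trans (@cap_vertex_far t 0 n _) _; last by lra.
by move=> c nc; apply: nt; exists c.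
Qed.

Lemma uncapped_hole t : ~ uncapped_polyhedron (hole t).
Proof. by move=> [_ /(_ t)[a]]; rewrite cap_hole; lra. Qed.

(** A cap is an intersection of three half-spaces, and a point of the segment in
the cap of t violates each of the three complementary inequalities; so one of
its ends does. *)
Lemma uncapped_not_sees p q :
  uncapped_polyhedron p -> uncapped_polyhedron q ->
  ~ sees uncapped_polyhedron p q ->
  exists t, forall a, 4^-1 < cap t a p \/ 4^-1 < cap t a q.
Proof.
move=> [Kp _] [Kq _] /not_seesP[l [l0 l1 /not_andP[]]].
  by have := separating_conv Kp Kq l0 l1.
move=> /existsNP[t /forallNP nt]; exists t => a.
have /negP := nt a; rewrite -ltNge moment_form_conv => gt4.
apply: contrapT => /not_orP[/negP + /negP]; rewrite -!leNgt => pa qa.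
have l1' : 0 <= 1 - l by rewrite subr_ge0.
have := ler_wpM2l l0 pa; have := ler_wpM2l l1' qa.
by move: gt4; clear; lra.
Qed.

Lemma uncapped_star n : (forall t a, T t a <> n) ->
  star_shaped uncapped_polyhedron.
Proof.
move=> nT; exists (vertex n); first exact: uncapped_vertex.
move=> p Xp; apply: contrapT => /(uncapped_not_sees (uncapped_vertex n) Xp).
move=> [t capt]; have [a pa] := Xp.2 t.
have far : cap t a (vertex n) <= - 4 by apply: cap_vertex_far => b /esym/nT.
by case: (capt a); move: pa far; clear; lra.
Qed.

Lemma uncapped_closed : closed uncapped_polyhedron.
Proof.
have formC (q r : {poly R}) (k y : R) :
    closed [set p : 'rV[R]_6 | moment_form q p + k * moment_form r p <= y].
  apply: (@closed_comp _ _ (fun p => moment_form q p + k * moment_form r p)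
    [set z | z <= y]); last exact: closed_le.
  move=> p _; apply: (@continuousD _ _ _ (moment_form q)).
    exact: moment_form_continuous.
  apply: (@continuousM _ _ (fun=> k)); first exact: cst_continuous.
  exact: moment_form_continuous.
have capC t a : closed [set p : 'rV[R]_6 | cap t a p <= 4^-1].
  by have := formC (cap_poly t a) 0 0 4^-1; under eq_set do rewrite mul0r addr0.
have -> : uncapped_polyhedron = separating_polyhedron `&`
    \bigcap_t ([set p | cap t 0 p <= 4^-1] `|` [set p | cap t 1 p <= 4^-1]
      `|` [set p | cap t 2 p <= 4^-1]).
  apply/seteqP; split=> p [Kp Xp]; split=> // t; last first.
    by have [[|]|] := Xp t Logic.I; [exists 0|exists 1|exists 2].
  move=> _; have [a] := Xp t; move: a.
  by apply: ord3P => ?; [left; left|left; right|right].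
apply: closedI; last by apply: closed_bigI => t _; do 2!apply: closedU => //.
rewrite (_ : separating_polyhedron = \bigcap_(i in [set i : I * I * 'I_3 * 'I_3 |
    i.1.1.1 <> i.1.1.2 /\ forall c, T i.1.1.1 i.1.2 <> T i.1.1.2 c])
  [set p | cap i.1.1.1 i.1.2 p + 4^-1 * cap i.1.1.2 i.2 p
    <= 4^-1 + 4^-1 * 4^-1]); first by apply: closed_bigI => i _; exact: formC.
apply/seteqP; split=> [p Kp [[[t s] a] b] /= [ts nT]|p Kp t s a b ts nT].
  exact: Kp.
exact: (Kp (t, s, a, b)).
Qed.

(** By linearity one of the two vertices a and b of s lies outside t, and the
separating inequality for that vertex applies. *)
Lemma caps_disjoint p s t a b c :
  separating_polyhedron p -> s <> t -> a <> b ->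
  4^-1 < cap s a p -> 4^-1 < cap s b p -> cap t c p <= 4^-1.
Proof.
move=> Kp st ab pa pb.
have far d : 4^-1 < cap s d p -> (forall e, T s d <> T t e) ->
    cap t c p <= 4^-1.
  by move=> pd nT; move: pd (Kp s t d c st nT); clear; lra.
have [[e ae]|] := pselect (exists e, T s a = T t e); last first.
  by move=> /forallNP; exact: far.
have [[f bf]|] := pselect (exists f, T s b = T t f); last first.
  by move=> /forallNP; exact: far.
by case: st; apply: T_linear ab ae bf.
Qed.

(** The edge meant is the one opposite to the vertex a of t. *)
Definition near_edge p a :=
  exists t, forall b, b <> a -> 4^-1 < cap t b p.

Definition cap_color p : option 'I_3 := [pick a | `[< near_edge p a >] ].

Lemma ord3_majority (P Q : 'I_3 -> Prop) : (forall a, P a \/ Q a) ->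
  exists a, (forall b, b <> a -> P b) \/ (forall b, b <> a -> Q b).
Proof.
move=> PQ.
have [P0|Q0] := PQ 0; have [P1|Q1] := PQ 1; have [P2|Q2] := PQ 2;
  first [ by exists 0; left; apply: ord3P | by exists 1; left; apply: ord3P
        | by exists 2; left; apply: ord3P | by exists 0; right; apply: ord3P
        | by exists 1; right; apply: ord3P | by exists 2; right; apply: ord3P].
Qed.

Lemma ord3_others (a : 'I_3) : exists b c, [/\ b <> a, c <> a & b <> c].
Proof.
move: a; apply: ord3P; [exists 1, 2 | exists 0, 2 | exists 0, 1]; by split.
Qed.

(** With the fourth colour [None], each of p and q exceeds 1/4 on at most one of
the three forms of t, which do not suffice. With the colour [Some a], the triple
that gives p its colour must be t itself, since otherwise all forms of t are
small at p and q would lie in the cap; then the form of a is small at p, and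
likewise at q. *)
Lemma uncapped_same_color p q t :
  uncapped_polyhedron p -> uncapped_polyhedron q ->
  (forall a, 4^-1 < cap t a p \/ 4^-1 < cap t a q) ->
  cap_color p <> cap_color q.
Proof.
move=> Xp Xq capt; rewrite /cap_color.
case: pickP => [a /asboolP pa|np]; last first.
  case: pickP => // nq _.
  have [a [pa|qa]] := ord3_majority capt.
    by have /asboolP := np a; apply; exists t.
  by have /asboolP := nq a; apply; exists t.
case: pickP => // b /asboolP + [ab]; rewrite -{b}ab => qa.
have same x y : uncapped_polyhedron x -> uncapped_polyhedron y ->
    near_edge x a -> (forall a, 4^-1 < cap t a x \/ 4^-1 < cap t a y) ->
    cap t a x <= 4^-1.
  move=> Xx Xy [s sx] txy; have [st|st] := pselect (s = t).
    rewrite st in sx; have [d xd] := Xx.2 t.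
    have [<- //|/eqP /sx] := eqVneq d a.
    by rewrite ltNge xd.
  have [d [e [da ea de]]] := ord3_others a.
  have [f yf] := Xy.2 t.
  have xc c := caps_disjoint c Xx.1 st de (sx d da) (sx e ea).
  by case: (txy f); rewrite ltNge ?xc ?yf.
have pa' := same p q Xp Xq pa capt.
have qa' := same q p Xq Xp qa (fun c => iffLR (or_comm _ _) (capt c)).
by case: (capt a); rewrite ltNge ?pa' ?qa'.
Qed.

Lemma chi_uncapped : (chi uncapped_polyhedron <= 4%:E)%E.
Proof.
have <- : #|{: option 'I_3}|%:R = 4 :> R by rewrite card_option card_ord.
apply: (chi_le (c := fun p : uncapped_polyhedron => cap_color (\val p))) => p q.
have Xp : uncapped_polyhedron (\val p) := set_valP p.
have Xq : uncapped_polyhedron (\val q) := set_valP q.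
by move=> /(uncapped_not_sees Xp Xq)[t]; exact: uncapped_same_color.
Qed.

End Triples.

Theorem theorem3 (R : realType) (g : nat) (g_gt0 : (0 < g)%N) :
  (exists X : set 'rV[R]_6,
     [/\ star_shaped X,
         chi X = 2%:E
       & (g%:R%:E <= convexity_number X)%E]) /\
  (exists Xc : set 'rV[R]_6,
     [/\ star_shaped Xc,
         closed Xc,
         (chi Xc <= 4%:E)%E
       & (g%:R%:E <= convexity_number Xc)%E]).
Proof.
have inj := triangle_edges_inj; have lin := triangle_edges_linear.
have unav := triangle_edges_unavoidable.
split.
  exists (punctured_faces triangle_edges); split.
  - exact: (punctured_star inj lin triangle_edges_diag).
  - exact: chi_punctured.
  - rewrite (convexity_number_punctured unav) ?leey //.
      exact: punctured_vertex.
    exact: punctured_hole.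
exists (uncapped_polyhedron triangle_edges); split.
- exact: (uncapped_star inj triangle_edges_diag).
- exact: uncapped_closed.
- exact: chi_uncapped.
- rewrite (convexity_number_punctured unav) ?leey //.
    exact: uncapped_vertex.
  exact: uncapped_hole.
Qed.
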